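(* There is a bijection $\psi$ from $\mathcal{R}_n(1221)$ to the set of Dyck paths of semilength $n$ such that, for every $R\in\mathcal{R}_n(1221)$, the maximum of $R$ equals one plus the number of double rises in the path $\psi(R)$. As a consequence, denoting by $f_{n,k}$ the number of elements of $\mathcal{R}_n(1221)$ whose maximum is $k$, one has $f_{n,k}=\mathfrak{n}_{n,k}$, where $\mathfrak{n}_{n,k}$ is the $(n,k)$-th Narayana number.
   Context: Here $n\ge1$ and $1\le k\le n$. A restricted growth function (RGF) of length $n$ is a sequence of positive integers $r_1\cdots r_n$ with $r_1=1$ and $r_i\le 1+\max\{r_1,\dots,r_{i-1}\}$ for $i\ge2$. The standardization $\mathrm{std}(Q)$ of an integer sequence replaces all occurrences of its $i$-th smallest distinct value by $i$, for all $i$. An RGF $R$ contains $Q$ if some subsequence of $R$ has standardization equal to $Q$; otherwise it avoids $Q$. $\mathcal{R}_n(Q)$ is the set of RGFs of length $n$ avoiding $Q$. A Dyck path of semilength $n$ is a lattice path from $(0,0)$ to $(2n,0)$ with steps $U=(1,1)$ and $D=(1,-1)$ that never goes below the $x$-axis. A double rise is an occurrence of two consecutive steps $UU$. The Narayana numbers are $\mathfrak{n}_{n,k}=\frac1n\binom{n}{k}\binom{n}{k-1}$ for $1\le k\le n$. *)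

(* Defs.v *)
From HB Require Import structures.
From mathcomp Require Import all_boot all_order all_algebra.

Set Implicit Arguments.
Unset Strict Implicit.
Unset Printing Implicit Defensive.

Import Order.TTheory GRing.Theory Num.Theory.

Definition seq_max (r : seq nat) : nat := \max_(x <- r) x.

(* Positions are counted from 0: the entry r_(i+1) is [nth 0 r i], and
   [take i r] is r_1 ... r_i. *)
Definition is_rgf (r : seq nat) : bool :=
  [&& all (leq 1) r,
      nth 0 r 0 == 1
    & all (fun i => nth 0 r i <= 1 + seq_max (take i r)) (iota 1 (size r).-1)].

Definition std (q : seq nat) : seq nat :=
  [seq (index x (sort leq (undup q))).+1 | x <- q].

(* The subsequences of r are the [mask m r], m ranging over the bit
   sequences of the same length. *)
Definition contains (r q : seq nat) : bool :=
  [exists m : (size r).-tuple bool, std (mask m r) == q].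

Definition avoids (r q : seq nat) : bool := ~~ contains r q.

Record rgf_avoiding (n : nat) (q : seq nat) := RgfAvoiding {
  rgf_word :> n.-tuple nat;
  _ : is_rgf rgf_word && avoids rgf_word q
}.

HB.instance Definition _ n q := [isSub for @rgf_word n q].
HB.instance Definition _ n q := [Countable of rgf_avoiding n q by <:].

(* The entries of an RGF of length n are at most n, so there are finitely
   many of them. *)
Lemma rgf_nth_le (r : seq nat) (i : nat) : is_rgf r -> nth 0 r i <= i.+1.
Proof.
case/and3P=> _ /eqP r0 /allP rS.
elim/ltn_ind: i => -[|i] IHi; first by rewrite r0.
have [ltir|] := ltnP i.+1 (size r); last by move/(nth_default 0)=> ->.
have ini : i.+1 \in iota 1 (size r).-1.
  by rewrite mem_iota add1n prednK ?(leq_trans _ ltir).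
apply: leq_trans (rS _ ini) _; rewrite add1n ltnS /seq_max.
apply/bigmax_leqP_seq => x /(nthP 0)[j]; rewrite size_take ltir => ltji <- _.
by rewrite nth_take // (leq_trans (IHi j ltji)).
Qed.

Definition rgf_code n q (r : rgf_avoiding n q) : n.-tuple 'I_n.+1 :=
  map_tuple inord r.

Definition rgf_decode n q (t : n.-tuple 'I_n.+1) :
    option (rgf_avoiding n q) :=
  insub (map_tuple val t).

Lemma rgf_codeK n q : pcancel (@rgf_code n q) (@rgf_decode n q).
Proof.
move=> r; rewrite /rgf_decode -[RHS]valK; congr insub; apply: val_inj => /=.
have /andP[rgf_r _] := valP r.
rewrite -map_comp -[RHS]map_id; apply/eq_in_map => x /(nthP 0)[i].
rewrite size_tuple => ltin <- /=; rewrite inordK //.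
by rewrite ltnS (leq_trans (rgf_nth_le i rgf_r)).
Qed.

HB.instance Definition _ n q : isFinite (rgf_avoiding n q) :=
  PCanIsFinite (@rgf_codeK n q).

(* A path is the sequence of its steps: true is U = (1,1), false is
   D = (1,-1). *)
Definition height (p : seq bool) : int :=
  (\sum_(s <- p) (if s then 1 else -1))%R.

Definition is_dyck (p : seq bool) : bool :=
  (height p == 0%R) &&
  all (fun i => (0 <= height (take i p))%R) (iota 0 (size p).+1).

Record dyck_path (n : nat) := DyckPath {
  dyck_word :> (n.*2).-tuple bool;
  _ : is_dyck dyck_word
}.

HB.instance Definition _ n := [isSub for @dyck_word n].
HB.instance Definition _ n := [Finite of dyck_path n by <:].

Definition double_rises (p : seq bool) : nat :=
  count (fun i => nth false p i && nth false p i.+1) (iota 0 (size p).-1).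

Definition num_avoiding_max (q : seq nat) (n k : nat) : nat :=
  #|[set R : rgf_avoiding n q | seq_max R == k]|.

Definition narayana (n k : nat) : rat :=
  (n%:R^-1 * 'C(n, k)%:R * 'C(n, (k - 1)%N)%:R)%R.

(* Main.v *)
Require Import Defs.
From HB Require Import structures.
From mathcomp Require Import all_boot all_order all_algebra.
From mathcomp Require Import zify ring.

(** An RGF avoids 1221 exactly when its repetitions, that is, its letters that
    have occurred before, form a weakly increasing sequence: in an RGF the
    first [a] precedes every [b > a], so an [a] occurring after two copies of
    [b] always completes a pattern [a b b a]. Hence such a word can be extended
    knowing only its maximum [m] and its last repeated value [v], taken to be 1
    when there is none: the next letter is either [m + 1] or some [x] with
    [v <= x <= m] ([continuation], [rgf_avoidingE]).

    The bijection translates each letter into one up step. A new value gives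
    the up step alone, and a repetition of [x] gives it after a run of
    [x - v + 1] down steps; the final run returns to the axis. The height
    in state [(m, v)] is [m - v + 1], so the inequality [x <= m] says that the
    path does not cross the axis, and the letters can be recovered from the
    lengths of the runs ([path_ofK], [word_ofK]). An up step directly follows
    another one exactly when its letter, other than the first, is a new value,
    so double rises count the increases of the maximum from 1 on.

    For the enumeration, let [W (l, r, h)] be the number of ways to append [l]
    letters, [r] of them repetitions, in a state with [m - v = h]. Looking at
    the next letter yields a recursion for [W], solved by the determinant
      [C(l, r) C(l + h, r) - C(l + h, r - 1) C(l, r + 1)]
    ([size_continuations]). An RGF of length [n] with maximum [k] has [n - k]
    repetitions, and [W (n - 1, n - k, 0)] is the Narayana number. *)

Set Implicit Arguments.
Unset Strict Implicit.
Unset Printing Implicit Defensive.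

Import GRing.Theory Num.Theory.

(** * RGFs avoiding 1221, letter by letter *)

Lemma seq_max_rcons s x : seq_max (rcons s x) = maxn (seq_max s) x.
Proof. by rewrite /seq_max -cats1 big_cat big_seq1. Qed.

(** RGFs are built letter by letter from the left, so most arguments below
    are inductions on the last letter. *)
Lemma rgf_rcons s x :
  0 < size s -> is_rgf (rcons s x) = is_rgf s && (1 <= x <= 1 + seq_max s).
Proof.
case: s => // y s _; rewrite /is_rgf all_rcons size_rcons.
rewrite rcons_cons [nth _ _ 0]/= [nth _ (y :: s) 0]/= -!pred_Sn -rcons_cons.
have -> : iota 1 (size (y :: s)) = rcons (iota 1 (size s)) (size (y :: s)).
  by rewrite [size (y :: s)]/= -(addn1 (size s)) iotaD cats1 addnC.
rewrite all_rcons nth_rcons ltnn eqxx -{1}cats1 take_size_cat //.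
set P := all _ (iota _ _); set Q := all _ (iota _ _).
have <- : P = Q.
  apply: eq_in_all => i; rewrite mem_iota add1n ltnS => /andP[i0 ile].
  case: i i0 ile => // i _ ile /=.
  by rewrite nth_rcons ile -cats1 takel_cat // ltnW.
by move: P; case: (all _ _) (y == 1) (1 <= x) (x <= _) => [] [] [] [] [].
Qed.

Lemma rgf_cat s t : 0 < size s -> is_rgf (s ++ t) -> is_rgf s.
Proof.
move=> s0; elim/last_ind: t => [|t x IH]; first by rewrite cats0.
by rewrite -rcons_cat rgf_rcons ?size_cat ?addn_gt0 ?s0 // => /andP[/IH].
Qed.

Lemma rgf1 x : is_rgf [:: x] = (x == 1).
Proof. by rewrite /is_rgf /= !andbT; case: eqP => [->|]; rewrite ?andbF. Qed.

(** No value is skipped: an RGF with maximum [M] uses exactly 1, ..., [M]. *)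
Lemma mem_rgf s x : is_rgf s -> (x \in s) = (1 <= x <= seq_max s).
Proof.
elim/last_ind: s => [//|s y IH].
case: s IH => [_|z s IH].
  by rewrite rgf1 => /eqP->; rewrite inE /seq_max big_seq1; lia.
rewrite rgf_rcons // => /andP[/IH{}IH].
rewrite mem_rcons in_cons {}IH seq_max_rcons; move: (seq_max _) => M; lia.
Qed.

Lemma subseq_rcons2 (T : eqType) (p q : seq T) x y :
  subseq (rcons p x) (rcons q y) =
  (x == y) && subseq p q || subseq (rcons p x) q.
Proof.
rewrite -subseq_rev !rev_rcons /= -(subseq_rev (rcons p x)) rev_rcons.
case: eqP => //= _; rewrite subseq_rev; apply/idP/orP => [->|[]//]; first by left.
by rewrite -(subseq_rev p); apply: subseq_trans; apply: subseq_cons.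
Qed.

(** The sorted list of distinct values of [a b c d] has [a] at index 0 and [b]
    at index 1 when its standardization is 1221, which forces [d = a], [c = b]
    and [a < b]. *)
Lemma contains_1221P r :
  reflect (exists a b, a < b /\ subseq [:: a; b; b; a] r)
          (contains r [:: 1; 2; 2; 1]).
Proof.
apply: (iffP existsP) => [[t /eqP stdE]|[a [b [ltab /subseqP[m sm mE]]]]].
  set s := mask t r in stdE.
  have ss : subseq s r by apply/subseqP; exists (tval t); rewrite ?size_tuple.
  move: s ss stdE => s ss.
  case: s ss => [|a [|b [|c [|d [|? ?]]]]] // ss; rewrite /std.
  set u := sort _ _; move=> -[ia ib ic id].
  have inu x : (x \in u) = (x \in [:: a; b; c; d]).
    by rewrite mem_sort mem_undup.
  have nthu x : x \in [:: a; b; c; d] -> x = nth 0 u (index x u).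
    by rewrite -inu => xu; rewrite nth_index.
  have au : a = nth 0 u 0 by rewrite {1}(nthu a) ?ia // !inE eqxx.
  have bu : b = nth 0 u 1 by rewrite {1}(nthu b) ?ib // !inE eqxx ?orbT.
  have cb : c = b by rewrite bu {1}(nthu c) ?ic // !inE eqxx ?orbT.
  have da : d = a by rewrite au {1}(nthu d) ?id // !inE eqxx ?orbT.
  exists a, b; split; last by rewrite cb da in ss.
  have u1 : 1 < size u by rewrite -ib index_mem inu !inE eqxx orbT.
  have : sorted ltn u.
    rewrite ltn_sorted_uniq_leq sort_uniq undup_uniq.
    by rewrite sort_sorted //; apply: leq_total.
  rewrite au bu; case: (u) u1 => [|e [|f ?]] //= _ /andP[] //.
have st : size m == size r by apply/eqP.
exists (Tuple st); rewrite -mE.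
rewrite /std /undup !inE !eqxx (gtn_eqF ltab) (ltn_eqF ltab) !orbT.
have -> : sort leq [:: b; a] = [:: a; b].
  by rewrite /sort /= leqNgt ltab.
by rewrite /= !eqxx (ltn_eqF ltab).
Qed.

(** In an RGF a smaller value makes its first appearance before a larger one
    does. Thus two copies of [b] already give [x b b], and a further [x]
    completes the forbidden pattern. *)
Lemma rgf_subseq_smaller s x b :
  is_rgf s -> 1 <= x < b -> b \in s -> subseq (x :: nseq (count_mem b s) b) s.
Proof.
move=> rgf_s /andP[x1 ltxb]; elim/last_ind: s rgf_s => [//|s y IH].
case: (posnP (size s)) => [/size0nil->|s0].
  by rewrite rgf1 => /eqP->; rewrite inE => /eqP bE; move: ltxb x1; rewrite bE; lia.
rewrite rgf_rcons // => /andP[rgf_s yle].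
rewrite mem_rcons in_cons -cats1 count_cat /= addn0.
have sub_s : subseq s (s ++ [:: y]) := prefix_subseq _ _.
case: (eqVneq y b) => [yb _|neqyb] /=; last first.
  by rewrite addn0 => /(IH rgf_s)/subseq_trans; apply.
rewrite {}yb in yle sub_s *; case: (boolP (b \in s)) => [bs|bs].
  rewrite nseqD -cat_cons; apply: cat_subseq => //; exact: IH.
rewrite (count_memPn bs) add0n /= -[[:: x; b]]/([:: x] ++ [:: b]).
apply: cat_subseq => //; rewrite sub1seq mem_rgf //; lia.
Qed.

(** In an RGF avoiding 1221 the largest repeated value is also the latest one
    to have been repeated. Before any repetition it is 1, which imposes no
    constraint on the next letter. *)
Definition top_repeat (s : seq nat) : nat :=
  maxn 1 (\max_(b <- s | 1 < count_mem b s) b).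

Lemma top_repeat_leP s x :
  1 <= x ->
  reflect (forall b, 1 < count_mem b s -> b <= x) (top_repeat s <= x).
Proof.
move=> x1; rewrite geq_max x1 /=.
apply: (iffP (bigmax_leqP_seq _ _ _ _)) => H b; last by move=> _; apply: H.
by move=> cb; apply: (H b) => //; rewrite -has_pred1 has_count ltnW.
Qed.

Lemma leq_top_repeat s b : 1 < count_mem b s -> b <= top_repeat s.
Proof.
have /(top_repeat_leP s) : 1 <= top_repeat s by rewrite leq_max.
by move=> /elimT; apply.
Qed.

(** A new occurrence of the pattern must use the last letter [x] as its final
    1, hence needs a larger value that is already repeated; conversely, by
    [rgf_subseq_smaller], any such value produces the pattern. *)
Lemma avoids_rcons s x :
  is_rgf s -> 1 <= x ->
  avoids (rcons s x) [:: 1; 2; 2; 1] =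
  avoids s [:: 1; 2; 2; 1] && (top_repeat s <= x).
Proof.
move=> rgf_s x1; apply/idP/andP => [av|[av /(top_repeat_leP _ x1) top]].
  split.
    apply: contraNN av => /contains_1221P[a [b [ltab sub]]].
    apply/contains_1221P; exists a, b; split=> //.
    exact: subseq_trans sub (subseq_rcons _ _).
  apply/top_repeat_leP => // b cb; rewrite leqNgt; apply: contraNN av => ltxb.
  apply/contains_1221P; exists x, b; split=> //.
  rewrite -[X in subseq X]/(rcons (x :: nseq 2 b) x) subseq_rcons2 eqxx.
  have bs : b \in s by rewrite -has_pred1 has_count ltnW.
  have := rgf_subseq_smaller rgf_s (introT andP (conj x1 ltxb)) bs.
  rewrite -(subnKC cb) nseqD -cat_cons => sub.
  by rewrite (subseq_trans (prefix_subseq _ _) sub).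
apply: contraNN av => /contains_1221P[a [b [ltab]]].
rewrite -[[:: a; b; b; a]]/(rcons (a :: nseq 2 b) a) subseq_rcons2.
case/orP=> [/andP[/eqP ax sub]|sub]; last by apply/contains_1221P; exists a, b.
have : 1 < count_mem b s.
  by apply: leq_trans (leq_count_subseq _ sub); rewrite /= eqxx; lia.
by move/top; lia.
Qed.

Lemma top_repeat_new s x : x \notin s -> top_repeat (rcons s x) = top_repeat s.
Proof.
move=> xs; apply/eqP; rewrite eqn_leq; apply/andP; split; apply/top_repeat_leP;
  rewrite ?leq_max // => b; rewrite -cats1.
  rewrite count_cat /= addn0; case: eqVneq => [<-|_].
    by rewrite (count_memPn xs).
  by rewrite addn0; apply: leq_top_repeat.
by move=> cb; apply: leq_top_repeat; rewrite count_cat ltn_addr.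
Qed.

Lemma top_repeat_again s x :
  1 <= x -> x \in s -> top_repeat s <= x -> top_repeat (rcons s x) = x.
Proof.
move=> x1 xs /(top_repeat_leP _ x1) top; apply/eqP; rewrite eqn_leq.
apply/andP; split.
  apply/top_repeat_leP => // b; rewrite -cats1 count_cat /= addn0.
  by case: eqVneq => [->|_] //; rewrite addn0 => /top.
apply: leq_top_repeat.
by rewrite -cats1 count_cat /= eqxx addn1 ltnS -has_count has_pred1.
Qed.

(** The letters that may follow a prefix with maximum [m] and last repeated
    value [v]: either the new value [m.+1], or a repetition, and the
    repetitions must increase weakly. *)
Fixpoint continuation (m v : nat) (w : seq nat) : bool :=
  if w is x :: w' then
    if x == m.+1 then continuation m.+1 v w'
    else (v <= x <= m) && continuation m x w'
  else true.

Lemma avoids_1221_cat s t :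
  avoids (s ++ t) [:: 1; 2; 2; 1] -> avoids s [:: 1; 2; 2; 1].
Proof.
apply: contraNN => /contains_1221P[a [b [ltab sub]]].
apply/contains_1221P; exists a, b; split=> //.
exact: subseq_trans sub (prefix_subseq _ _).
Qed.

(** The future of an RGF avoiding 1221 depends on its past only through the
    pair of its maximum and its top repeat. *)
Lemma rgf_avoiding_cat s w :
  is_rgf s -> avoids s [:: 1; 2; 2; 1] ->
  is_rgf (s ++ w) && avoids (s ++ w) [:: 1; 2; 2; 1] =
  continuation (seq_max s) (top_repeat s) w.
Proof.
elim: w s => [|x w IH] s rgf_s av_s /=; first by rewrite cats0 rgf_s.
have s0 : 0 < size s by case: (s) rgf_s.
have tM : top_repeat s <= seq_max s.
  apply/top_repeat_leP.
    have : head 0 s \in s by case: (s) s0 => // *; rewrite mem_head.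
    by rewrite mem_rgf // => /andP[]; apply: leq_trans.
  move=> b cb; have : b \in s by rewrite -has_pred1 has_count ltnW.
  by rewrite mem_rgf // => /andP[].
have t1 : 1 <= top_repeat s by rewrite leq_max.
have := rgf_rcons x s0; rewrite rgf_s /= => rgfE.
rewrite -cat_rcons; case: eqP => [xE|neqx].
  rewrite IH ?rgfE ?avoids_rcons ?av_s //; try lia.
  rewrite seq_max_rcons top_repeat_new; last by rewrite mem_rgf //; lia.
  by congr continuation; lia.
case: (boolP (_ <= x <= _)) => [/andP[tx xM]|bad] /=.
  rewrite IH ?rgfE ?avoids_rcons ?av_s //; try lia.
  rewrite seq_max_rcons top_repeat_again //; first by congr continuation; lia.
    lia.
  by rewrite mem_rgf //; lia.
apply/negP => /andP[rgf_sw av_sw].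
have : is_rgf (rcons s x) by apply: rgf_cat rgf_sw; rewrite size_rcons.
rewrite rgfE => x_range; move/avoids_1221_cat: av_sw; rewrite avoids_rcons //; lia.
Qed.

Lemma rgf_avoidingE r :
  is_rgf r && avoids r [:: 1; 2; 2; 1] =
  if r is x :: w then (x == 1) && continuation 1 1 w else false.
Proof.
case: r => [//|x w]; case: eqP => [->|neqx1].
  have rgf_1 : is_rgf [:: 1] by rewrite rgf1.
  rewrite -[1 :: w]/([:: 1] ++ w) rgf_avoiding_cat //.
  - by rewrite /seq_max /top_repeat big_seq1 big_cons big_nil.
  - apply/negP => /contains_1221P[a [b [_ /size_subseq]]] //.
by rewrite /is_rgf /=; case: eqP => //; rewrite andbF.
Qed.

(** * The bijection with Dyck paths *)

(** The height is carried along as a natural number, so that never going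
    below the axis becomes the failure of a down step at height 0. *)
Fixpoint dyck_from (h : nat) (p : seq bool) : bool :=
  match p with
  | [::] => h == 0
  | true :: p' => dyck_from h.+1 p'
  | false :: p' => if h is h'.+1 then dyck_from h' p' else false
  end.

Lemma height_cons s p : (height (s :: p) = (if s then 1 else -1) + height p)%R.
Proof. by rewrite /height big_cons. Qed.

Lemma dyck_fromE h p :
  ((h%:Z + height p == 0)%R &&
   all (fun i => (0 <= h%:Z + height (take i p))%R) (iota 0 (size p).+1)) =
  dyck_from h p.
Proof.
elim: p h => [|s p IH] h.
  by rewrite /= /height big_nil; apply/idP/idP; lia.
rewrite -[size (s :: p)]/(size p).+1 -[iota 0 _]/(0 :: iota (1 + 0) (size p).+1).
rewrite iotaDl /all -/(all _ _) all_map.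
rewrite [X in X && all _ _](_ : _ = true); last by rewrite /height big_nil; lia.
case: s => [|].
  rewrite -[dyck_from _ _]/(dyck_from h.+1 p) -IH; congr (_ && _).
    by rewrite height_cons /=; apply/eqP/eqP; lia.
  by apply: eq_all => i /=; rewrite height_cons add0n; lia.
case: h => [|h]; first by rewrite /= !height_cons take0 [height [::]]big_nil andbF.
rewrite -[dyck_from _ _]/(dyck_from h p) -IH; congr (_ && _).
  by rewrite height_cons /=; apply/eqP/eqP; lia.
by apply: eq_all => i /=; rewrite height_cons add0n; lia.
Qed.

Lemma is_dyckE p : is_dyck p = dyck_from 0 p.
Proof.
rewrite -dyck_fromE /is_dyck GRing.add0r; congr (_ && _).
by apply: eq_all => i; rewrite GRing.add0r.
Qed.

Lemma dyck_from_downs h d p :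
  d <= h -> dyck_from h (nseq d false ++ p) = dyck_from (h - d) p.
Proof. by elim: d h => [|d IH] [|h] //= /IH ->. Qed.

Lemma double_rises_cons b c p :
  double_rises [:: b, c & p] = (b && c) + double_rises (c :: p).
Proof.
rewrite /double_rises /=; congr (_ + _).
by rewrite -[1]/(1 + 0) iotaDl count_map.
Qed.

(** A nonempty run of down steps separates the up steps around it, so a
    repetition creates no double rise. *)
Lemma double_rises_downs d p :
  double_rises (true :: nseq d.+1 false ++ p) = double_rises p.
Proof.
rewrite /= double_rises_cons /= add0n.
elim: d => [|d IH] /=; last by rewrite double_rises_cons.
by case: p => [|c p]; rewrite ?double_rises_cons.
Qed.

(** Every letter contributes exactly one up step. A new value contributes
    nothing else; a repetition of [x] first goes down [x - v + 1] steps, where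
    the extra 1 distinguishes repeating [v] itself from a new value. The height
    in state [(m, v)] is [m - v + 1], and the last run returns to the axis. *)
Fixpoint path_of (m v : nat) (w : seq nat) : seq bool :=
  match w with
  | [::] => nseq (m - v).+1 false
  | x :: w' =>
    if x == m.+1 then true :: path_of m.+1 v w'
    else nseq (x - v).+1 false ++ true :: path_of m x w'
  end.

(** Reads the path back, [c] being the length of the current run of down
    steps: an up step after an empty run is a new value, and after a run of
    length [c' + 1] it is a repetition of [v + c']. *)
Fixpoint word_of (m v c : nat) (p : seq bool) : seq nat :=
  match p with
  | [::] => [::]
  | false :: p' => word_of m v c.+1 p'
  | true :: p' =>
    if c is c'.+1 then (v + c') :: word_of m (v + c') 0 p'
    else m.+1 :: word_of m.+1 v 0 p'
  end.

Lemma path_of_dyck m v w :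
  v <= m -> continuation m v w -> dyck_from (m - v).+1 (path_of m v w).
Proof.
elim: w m v => [|x w IH] m v levm.
  by move=> _; rewrite -[path_of _ _ _]cats0 dyck_from_downs // subnn.
rewrite /=; case: eqP => [_|_] /=.
  by rewrite -subSn //; apply: IH; apply: leqW.
case/andP=> /andP[levx lexm] cont.
rewrite dyck_from_downs; last by lia.
by rewrite (_ : _ - _ = m - x); [exact: IH | lia].
Qed.

Lemma size_path_of m v w :
  v <= m -> continuation m v w -> size (path_of m v w) = (size w).*2 + (m - v).+1.
Proof.
elim: w m v => [|x w IH] m v levm.
  by move=> _; rewrite /= size_nseq.
rewrite /=; case: eqP => [_|_] /=.
  by move/IH => -> //; lia.
case/andP=> /andP[levx lexm] cont.
by rewrite size_cat size_nseq /= IH //; lia.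
Qed.

(** The leading up step is the one contributed by the previous letter: an up
    step is the second step of a double rise exactly when its letter raises the
    maximum. *)
Lemma double_rises_path_of m v w :
  v <= m -> continuation m v w ->
  m + double_rises (true :: path_of m v w) = maxn m (seq_max w).
Proof.
elim: w m v => [|x w IH] m v levm.
  move=> _; rewrite [path_of _ _ _]/= -[_ :: nseq _ _]cats0 -cat_cons.
  by rewrite double_rises_downs /seq_max big_nil maxn0 addn0.
rewrite [continuation _ _ _]/= [path_of _ _ _]/= /seq_max big_cons -/(seq_max w).
case: eqP => [->|_].
  by move=> /IH; rewrite double_rises_cons; lia.
case/andP=> /andP[levx lexm] cont.
by rewrite double_rises_downs IH //; lia.
Qed.

Lemma word_of_downs m v c d p :
  word_of m v c (nseq d false ++ p) = word_of m v (c + d) p.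
Proof. by elim: d c => [|d IH] c; rewrite ?addn0 //= IH addSnnS. Qed.

Lemma path_ofK m v w :
  continuation m v w -> word_of m v 0 (path_of m v w) = w.
Proof.
elim: w m v => [|x w IH] m v.
  by move=> _; rewrite /= -[nseq _ _]cats0 word_of_downs.
rewrite [path_of _ _ _]/= [continuation _ _ _]/=.
case: eqP => [-> /IH|_]; first by rewrite /= => ->.
case/andP=> /andP[levx lexm] /IH wE.
rewrite /= word_of_downs /= (_ : v + (x - v) = x) ?wE //; lia.
Qed.

(** A run that stays above the axis has length [c' + 1 <= m - v + 1], so that
    the repeated value [v + c'] is at most [m]: this is where the Dyck
    condition gives back a valid letter. *)
Lemma word_ofK m v c p :
  v <= m -> c <= (m - v).+1 -> dyck_from ((m - v).+1 - c) p ->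
  continuation m v (word_of m v c p) /\
  path_of m v (word_of m v c p) = nseq c false ++ p.
Proof.
elim: p m v c => [|[] p IH] m v c levm lec /=.
- move=> c0; split=> //; rewrite cats0 -[LHS]/(nseq (m - v).+1 false).
  by congr nseq; lia.
- case: c lec => [|c] lec /= dyck.
    rewrite eqxx /=; case: (IH m.+1 v 0) => //; first exact: leqW.
      by move: dyck; rewrite !subn0 subSn.
    by move=> ? ->.
  rewrite (_ : (_ == m.+1) = false); last by lia.
  case: (IH m (v + c) 0) => //; first by lia.
    by rewrite subn0 (_ : (m - (v + c)).+1 = ((m - v).+1 - c.+1).+1) //; lia.
  move=> -> ->; split; first by rewrite andbT; lia.
  by rewrite addKn.
case hE: (_ - c) => [//|h] dyck.
case: (IH m v c.+1) => //; [by lia | by rewrite (_ : _ - _ = h) //; lia |].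
move=> -> ->; split=> //.
by rewrite -addn1 nseqD -catA.
Qed.

(** The first letter is always 1; it contributes the initial up step and leads
    to the state with maximum 1 and no repetition yet. *)
Definition dyck_word_of (r : seq nat) : seq bool := true :: path_of 1 1 (behead r).

Lemma dyck_word_of_dyck n r :
  is_rgf r && avoids r [:: 1; 2; 2; 1] -> size r = n ->
  is_dyck (dyck_word_of r) && (size (dyck_word_of r) == n.*2).
Proof.
rewrite rgf_avoidingE is_dyckE; case: r => // x w /andP[_ cont] <-.
rewrite /dyck_word_of /= size_path_of // subnn addn1 doubleS eqxx andbT.
exact: path_of_dyck (leqnn 1) cont.
Qed.

Lemma dyck_word_of_inj r s :
  is_rgf r && avoids r [:: 1; 2; 2; 1] -> is_rgf s && avoids s [:: 1; 2; 2; 1] ->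
  dyck_word_of r = dyck_word_of s -> r = s.
Proof.
rewrite !rgf_avoidingE; case: r => // x w /andP[/eqP-> cw].
case: s => // y t /andP[/eqP-> ct] [/= /(congr1 (word_of 1 1 0))].
by rewrite !path_ofK // => ->.
Qed.

Lemma dyck_word_of_surj n p :
  0 < n -> is_dyck p -> size p = n.*2 ->
  exists r,
    [/\ is_rgf r && avoids r [:: 1; 2; 2; 1], size r = n & dyck_word_of r = p].
Proof.
rewrite is_dyckE; case: p => [|[] p] //=; first by case: n.
move=> n0 dyck sz; have [//|//||cont pathE] := @word_ofK 1 1 0 p.
  by rewrite subnn.
exists (1 :: word_of 1 1 0 p); rewrite rgf_avoidingE; split=> //.
  by move: (size_path_of (leqnn 1) cont) sz; rewrite pathE /=; lia.
by rewrite /dyck_word_of /= pathE.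
Qed.

Lemma double_rises_dyck_word_of r :
  is_rgf r && avoids r [:: 1; 2; 2; 1] ->
  seq_max r = 1 + double_rises (dyck_word_of r).
Proof.
rewrite rgf_avoidingE; case: r => // x w /andP[/eqP-> cont].
by rewrite /dyck_word_of double_rises_path_of // /seq_max big_cons.
Qed.

Lemma dyck_bijection n : 0 < n ->
  exists psi : rgf_avoiding n [:: 1; 2; 2; 1] -> dyck_path n,
     bijective psi /\
     forall R : rgf_avoiding n [:: 1; 2; 2; 1], seq_max R = 1 + double_rises (psi R).
Proof.
move=> n0.
have psiP (R : rgf_avoiding n [:: 1; 2; 2; 1]) :
    exists P : dyck_path n, dyck_word_of R = P.
  have /andP[dyck sz] := dyck_word_of_dyck (valP R) (size_tuple R).
  by exists (@DyckPath n (Tuple sz) dyck).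
have phiP (P : dyck_path n) :
    exists R : rgf_avoiding n [:: 1; 2; 2; 1], dyck_word_of R = P.
  have [r [rP /eqP sz rE]] := dyck_word_of_surj n0 (valP P) (size_tuple P).
  by exists (@RgfAvoiding n _ (Tuple sz) rP).
have [psi psiE] := fin_all_exists psiP; have [phi phiE] := fin_all_exists phiP.
exists psi; split=> [|R]; last first.
  by rewrite double_rises_dyck_word_of ?psiE //; apply: (valP R).
exists phi => [R|P]; apply: val_inj; apply: val_inj => /=.
  apply: dyck_word_of_inj (valP (phi (psi R))) (valP R) _.
  exact: etrans (phiE _) (esym (psiE R)).
exact: etrans (esym (psiE _)) (phiE P).
Qed.

(** * Counting by length and maximum *)

(** The continuations of length [l] with [r] repetitions from the state
    [(m, v)]. Repeated letters are indexed by [j = m - x] because the number of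
    continuations from a state depends only on the difference of its two
    components. *)
Fixpoint continuations (l r m v : nat) : seq (seq nat) :=
  if l is l'.+1 then
    map (cons m.+1) (continuations l' r m.+1 v) ++
    (if r is r'.+1 then
       [seq (m - j) :: w | j <- iota 0 (m - v).+1, w <- continuations l' r' m (m - j)]
     else [::])
  else nseq (r == 0) [::].

(** Unfolds one letter without unfolding the [iota] of the repeated letters. *)
Lemma continuationsS l r m v :
  continuations l.+1 r m v =
  map (cons m.+1) (continuations l r m.+1 v) ++
  (if r is r'.+1 then
     [seq (m - j) :: w | j <- iota 0 (m - v).+1, w <- continuations l r' m (m - j)]
   else [::]).
Proof. by []. Qed.

(** Each letter raises the maximum by at most 1, so reaching [m + size w]
    leaves no room for a repetition. *)
Lemma max_continuation_le m v w :
  continuation m v w -> maxn m (seq_max w) <= m + size w.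
Proof.
elim: w m v => [|x w IH] m v; first by rewrite /seq_max big_nil /=; lia.
rewrite /seq_max big_cons -/(seq_max w) /=; case: eqP => [->|_].
  by move=> /IH; lia.
by move=> /andP[/andP[_ xm] /IH]; lia.
Qed.

(** A letter either raises the maximum by 1 or is a repetition, so prescribing
    the number of repetitions amounts to prescribing the final maximum. *)
Lemma mem_continuations l r m v w :
  v <= m ->
  (w \in continuations l r m v) =
  [&& size w == l, continuation m v w & r + maxn m (seq_max w) == m + l].
Proof.
elim: l r m v w => [|l IH] r m v w levm.
  case: w => [|x w]; last by case: r.
  by rewrite /seq_max big_nil /=; case: r => [|r]; rewrite ?inE ?in_nil ?eqxx /=; lia.
rewrite continuationsS mem_cat; case: w => [|x w].
  rewrite (_ : (_ \in map _ _) = false); last by apply/negP => /mapP[].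
  by case: r => // r; apply/negP => /allpairsPdep[j [w []]].
rewrite /seq_max big_cons -/(seq_max w) [size _]/= [continuation _ _ _]/= eqSS.
case: (x =P m.+1) => [->|neqx].
  rewrite mem_map; last by move=> ? ? [].
  rewrite IH; last exact: leqW.
  rewrite [X in _ || X](_ : _ = false); last first.
    by case: r => // r; apply/negP => /allpairsPdep[j [t [_ _ []]]]; lia.
  rewrite orbF; congr [&& _, _ & _]; apply/eqP/eqP; lia.
rewrite (_ : (_ \in map _ _) = false); last by apply/negP => /mapP[t _ []].
rewrite orFb; case: (boolP (v <= x <= m)) => [/andP[levx lexm]|bad];
  rewrite ?andFb ?andTb; last first.
  rewrite andbF; case: r => [//|r]; apply/negP => /allpairsPdep[j [t [+ _ []]]].
  by rewrite mem_iota; lia.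
case: r => [|r].
  rewrite in_nil; apply/esym/negP => /and3P[/eqP sw cont /eqP].
  have := max_continuation_le cont; lia.
transitivity (w \in continuations l r m x).
  apply/allpairsPdep/idP => [[j [t [_ tP [-> ->]]]] //|wP].
  exists (m - x), w; rewrite mem_iota (_ : m - (m - x) = x); last by lia.
  by split=> //; lia.
rewrite IH //; congr [&& _, _ & _]; apply/eqP/eqP; lia.
Qed.

Lemma uniq_continuations l r m v : uniq (continuations l r m v).
Proof.
elim: l r m v => [|l IH] [|r] m v //; rewrite continuationsS.
  by rewrite cats0 map_inj_uniq ?IH // => ? ? [].
rewrite cat_uniq map_inj_uniq ?IH; last by move=> ? ? [].
rewrite andTb; apply/andP; split.
  apply/hasPn => z /allpairsPdep[j [w [_ _ ->]]]; apply/negP => /mapP[t _ []]; lia.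
apply: allpairs_uniq_dep => [|x _|]; rewrite ?iota_uniq ?IH //.
move=> [i s] [j t] /allpairsPdep[i' [s' [+ _ [-> ->]]]].
move=> + /allpairsPdep[j' [t' [+ _ [-> ->]]]].
rewrite !mem_iota /= => ile jle [ijE ->]; have -> // : i' = j' by lia.
Qed.

(** Pascal's rule needs the value 0 at [r = 0], where truncated subtraction
    in ['C(n, r - 1)] would give 1. *)
Definition predbin (n r : nat) : nat := if r is r'.+1 then 'C(n, r') else 0.

Lemma binS_predbin n r : 'C(n.+1, r) = 'C(n, r) + predbin n r.
Proof. by case: r => [|r]; rewrite ?bin0 ?binS. Qed.

Section DeterminantCount.
Local Open Scope ring_scope.

(** Reading from the right, the continuations from a state with [m - v = h]
    correspond to pairs of [r]-subsets of [1, ..., l] and [1, ..., l + h] such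
    that the i-th smallest element of the first is at most that of the second:
    the first records where the repetitions occur, the second the values
    repeated. These are pairs of noncrossing lattice paths, and the formula is
    the 2 x 2 determinant that counts them. *)
Definition word_count (l r h : nat) : int :=
  'C(l, r)%:Z * 'C(l + h, r)%:Z - (predbin (l + h) r)%:Z * 'C(l, r.+1)%:Z.

(** The sum over the possible repeated letters telescopes to a difference of
    the same shape. *)
Lemma sum_word_count l r h :
  \sum_(j < h) word_count l r j =
  'C(l, r)%:Z * 'C(l + h, r.+1)%:Z - 'C(l + h, r)%:Z * 'C(l, r.+1)%:Z.
Proof.
elim: h => [|h IH]; first by rewrite big_ord0 addn0; ring.
rewrite big_ord_recr /= IH /word_count addnS binS (binS_predbin _ r); lia.
Qed.

(** Classifying the continuations by their first letter gives the recursion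
      [W (l + 1, r, h) = W (l, r, h + 1) + sum of W (l, r - 1, j) for j <= h],
    which the determinant satisfies by Pascal's rule. *)
Lemma size_continuations l r m v :
  (v <= m)%N -> (size (continuations l r m v))%:Z = word_count l r (m - v).
Proof.
elim: l r m v => [|l IH] r m v levm.
  rewrite /word_count (bin_small (ltn0Sn r)) mulr0 subr0 bin0n.
  by case: r => [|r]; rewrite ?bin0 ?mul0r.
rewrite continuationsS size_cat size_map PoszD IH; last exact: leqW.
rewrite subSn // /word_count !addnS !addSn.
case: r => [|r]; first by rewrite /= !bin0; lia.
rewrite size_allpairs_dep sumnE big_map.
rewrite -[iota 0 _]/(index_iota 0 (m - v).+1) big_mkord.
rewrite (big_morph Posz PoszD (erefl _)).
rewrite (eq_bigr (fun j : 'I__ => word_count l r j)); last first.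
  move=> j _; rewrite IH; last exact: leq_subr.
  by congr word_count; have := ltn_ord j; lia.
rewrite sum_word_count /= addnS (binS l r) (binS l r.+1).
ring.
Qed.

(** With [r = n - k], absorption writes all four binomial coefficients of the
    determinant as multiples of [C(n, r) / n] or [C(n, r + 1) / n], and
    [(n - r) (r + 1) - r (n - r - 1) = n]. *)
Lemma narayana_word_count n k :
  (1 <= k <= n)%N -> (word_count n.-1 (n - k) 0)%:~R = narayana n k.
Proof.
case: n => [|n] /andP[k1 kn]; first by lia.
set r := (n.+1 - k)%N; rewrite [n.+1.-1]/= /narayana.
rewrite -(bin_sub kn) -(@bin_sub _ (k - 1)) -/r; last by lia.
have -> : (n.+1 - (k - 1))%N = r.+1 by lia.
have n0 : n.+1%:R != 0 :> rat by rewrite pnatr_eq0.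
have absorb (a b c : nat) :
    (n.+1 * a = b * c)%N -> a%:R = b%:R * c%:R / n.+1%:R :> rat.
  by move=> E; rewrite -natrM -E natrM mulrC mulKf.
have E1 := absorb _ _ _ (mul_bin_down n.+1 r).
have E2 := absorb _ _ _ (mul_bin_diag n.+1 r).
have E3 := absorb _ _ _ (mul_bin_down n.+1 r.+1).
have E4 : (predbin n r)%:R = r%:R * 'C(n.+1, r)%:R / n.+1%:R :> rat.
  by apply: absorb; case: (r) => [|r'] /=; rewrite ?muln0 ?mul_bin_diag.
have nE : n.+1%:R = k%:R + r%:R :> rat by rewrite -natrD; congr _%:R; lia.
have kE : (n.+1 - r = k)%N by lia.
have k1E : (n.+1 - r.+1)%:R = k%:R - 1 :> rat.
  by apply: (addIr 1); rewrite subrK natr1; congr _%:R; lia.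
(* The two factors 'C(n, r) of the square are absorbed in different ways. *)
rewrite /word_count addn0 rmorphB !rmorphM /= -!pmulrn {1}E1 E2 E3 E4 kE k1E.
rewrite -[r.+1%:R]natr1 nE in n0 *.
by field.
Qed.

End DeterminantCount.

(** Dropping the initial 1 turns the RGFs of length [n] with maximum [k] into
    the continuations from the state [(1, 1)] having [n - 1] letters, [n - k] of
    them repetitions. *)
Lemma num_avoiding_max_continuations n k :
  1 <= k <= n ->
  num_avoiding_max [:: 1; 2; 2; 1] n k = size (continuations n.-1 (n - k) 1 1).
Proof.
move=> /andP[k1 kn]; rewrite /num_avoiding_max cardE.
set s := enum _.
rewrite -(size_map (fun R : rgf_avoiding n _ => behead R) s).
apply/perm_size/uniq_perm; last 2 first.
- exact: uniq_continuations.
- move=> w; rewrite mem_continuations //.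
  apply/mapP/and3P => [[R]|[/eqP sw cont /eqP mx]].
    rewrite mem_enum inE => /eqP mR ->.
    move: (valP R) (size_tuple R) mR; rewrite /= rgf_avoidingE.
    case: (tval _) => // x t /andP[/eqP-> cont] /= sz.
    by rewrite /seq_max big_cons -/(seq_max t) => mR; split=> //; lia.
  have sz : size (1 :: w) == n by rewrite /= sw; lia.
  have rP : is_rgf (1 :: w) && avoids (1 :: w) [:: 1; 2; 2; 1].
    by rewrite rgf_avoidingE.
  exists (@RgfAvoiding n _ (Tuple sz) rP) => //.
  by rewrite mem_enum inE /= /seq_max big_cons -/(seq_max w); lia.
rewrite map_inj_uniq ?enum_uniq // => R S bRS.
apply: val_inj; apply: val_inj => /=; move: (valP R) (valP S) bRS.
rewrite /= !rgf_avoidingE; case: (tval _) => // x t /andP[/eqP-> _].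
by case: (tval _) => // y u /andP[/eqP-> _] /= ->.
Qed.

(** * Dyck paths and Narayana numbers *)

Theorem theorem5p3 (n : nat) (n_ge1 : 1 <= n) :
  (exists psi : rgf_avoiding n [:: 1; 2; 2; 1] -> dyck_path n,
     bijective psi /\
     forall R : rgf_avoiding n [:: 1; 2; 2; 1],
       seq_max R = 1 + double_rises (psi R)) /\
  (forall k : nat, 1 <= k <= n ->
     ((num_avoiding_max [:: 1; 2; 2; 1] n k)%N%:R)%R = narayana n k).
Proof.
split; first exact: dyck_bijection.
move=> k k_range; rewrite num_avoiding_max_continuations //.
by rewrite pmulrn size_continuations // subnn narayana_word_count.
Qed.
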